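(* Let $k\ge2$. The poset $(\mathcal B_k,\preceq)$ is a finite join-semilattice with the maximum graph $K_{[k]}\circ K_{[2]^k}$.
   Context: All graphs are finite and simple. $[k]=\{1,\dots,k\}$; $[2]^k$ is the set of vectors $x=(x_{(1)},\dots,x_{(k)})$ with entries in $\{1,2\}$. $K_{[k]}$ and $K_{[2]^k}$ are the complete graphs on the vertex sets $[k]$ and $[2]^k$. For a graph $F$ and $S\subseteq V(F)$, $\mathcal E(F,S)$ is the set of all $S$-coverings in $F$, i.e. sets $E\subseteq E(F)$ such that every vertex of $S$ is incident to at least one edge of $E$. For a graph $H_1$ on $[k]$ and a graph $H_2$ on $[2]^k$, $H_1\circ H_2$ is the graph on the disjoint union $[k]\sqcup[2]^k$ with edge set $E(H_1)\cup E(H_2)\cup\{\{i,x\}: i\in[k],\ x\in[2]^k,\ x_{(i)}=1\}$. For a set $E$ of 2-subsets of $[2]^k$, $span(E)$ is the graph with vertex set $[2]^k$ and edge set $E$. For $I\subseteq[k]$ let $[2]^k_I(2)=\{x\in[2]^k: x_{(i)}=2\ \forall i\in I\}$. For $i\in[k]$ let $B^k_i$ be the complete bipartite graph with parts $\{x\in[2]^k:x_{(i)}=1\}$ and $\{x\in[2]^k:x_{(i)}=2\}$. For a graph $H_1$ on $[k]$, $H_1(i)$ is the union of $\{i\}$ and the set of neighbours of $i$ in $H_1$. Define $$\mathcal B_k=\Big\{H_1\circ span\Big(\bigcup_{i\in[k]}E_i\Big): H_1 \text{ a graph on } [k],\ E_i\in\mathcal E(B^k_i,[2]^k_{H_1(i)}(2))\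 \text{for each } i\in[k]\Big\}.$$ For graphs $G_1,G_2$ with the same vertex set, $G_1\preceq G_2$ means $G_1$ is a spanning subgraph of $G_2$, i.e. $E(G_1)\subseteq E(G_2)$. A join-semilattice is a poset in which any pair of elements has a least upper bound. A maximum element is an element $x$ with $a\preceq x$ for all $a$. *)

(* Defs.v *)
From HB Require Import structures.
From mathcomp Require Import all_boot.
From mathcomp Require classical_sets cardinality.

Set Implicit Arguments.
Unset Strict Implicit.
Unset Printing Implicit Defensive.

Record sgraph (T : finType) := SGraph {
  edges : {set {set T}};
  edges_card2 : [forall e in edges, #|e| == 2]
}.

HB.instance Definition _ (T : finType) := [isSub for @edges T].
HB.instance Definition _ (T : finType) := [Finite of sgraph T by <:].

Definition spanning_subgraph (T : finType) (G1 G2 : sgraph T) : bool :=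
  edges G1 \subset edges G2.

Lemma complete_card2 (T : finType) :
  [forall e in [set e : {set T} | #|e| == 2], #|e| == 2].
Proof. by apply/forall_inP => e; rewrite inE. Qed.

Definition complete (T : finType) : sgraph T := SGraph (complete_card2 T).

Lemma span_card2 (T : finType) (E : {set {set T}}) :
  [forall e in [set e in E | #|e| == 2], #|e| == 2].
Proof. by apply/forall_inP => e; rewrite inE => /andP[]. Qed.

(* The filter only serves to make [span] total: see [edges_span]. *)
Definition span (T : finType) (E : {set {set T}}) : sgraph T :=
  SGraph (span_card2 E).

Lemma edges_span (T : finType) (E : {set {set T}}) :
  (forall e : {set T}, e \in E -> #|e| = 2) -> edges (span E) = E.
Proof.
move=> E2; apply/setP => e; rewrite inE andb_idr // => eE.
by rewrite E2.
Qed.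

Definition coverings (T : finType) (F : sgraph T) (S : {set T}) :
    {set {set {set T}}} :=
  [set E : {set {set T}} | (E \subset edges F) &&
    [forall v in S, [exists e in E, v \in e]]].

Definition closed_neighbours (T : finType) (H : sgraph T) (i : T) : {set T} :=
  i |: [set j | [set i; j] \in edges H].

(* [k] is 'I_k and [2] is 'I_2, so that the entries 1 and 2 are the ordinals
   of value 0 and 1. *)
Definition entry1 : 'I_2 := ord0.
Definition entry2 : 'I_2 := ord_max.

Definition cube (k : nat) : finType := {ffun 'I_k -> 'I_2}.

Definition cube2 (k : nat) (I : {set 'I_k}) : {set cube k} :=
  [set x : cube k | [forall i in I, x i == entry2]].

Definition half (k : nat) (i : 'I_k) (a : 'I_2) : {set cube k} :=
  [set x : cube k | x i == a].

Definition bip_edges (k : nat) (i : 'I_k) : {set {set cube k}} :=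
  [set [set x; y] | x in half i entry1, y in half i entry2].

Lemma bip_card2 (k : nat) (i : 'I_k) :
  [forall e in bip_edges i, #|e| == 2].
Proof.
apply/forall_inP => e /imset2P[x y]; rewrite !inE => /eqP xi /eqP yi ->.
rewrite cards2; suff -> : x != y by [].
by apply/eqP => xy; move: xi; rewrite xy yi.
Qed.

Definition bip (k : nat) (i : 'I_k) : sgraph (cube k) := SGraph (bip_card2 i).

Definition circ_edges (k : nat) (H1 : sgraph 'I_k) (H2 : sgraph (cube k)) :
    {set {set 'I_k + cube k}} :=
  [set inl @: e | e : {set 'I_k} in edges H1] :|:
  [set inr @: e | e : {set cube k} in edges H2] :|:
  [set [set inl i; inr x] | i in [set: 'I_k], x in half i entry1].

Lemma circ_card2 (k : nat) (H1 : sgraph 'I_k) (H2 : sgraph (cube k)) :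
  [forall e in circ_edges H1 H2, #|e| == 2].
Proof.
apply/forall_inP => e; rewrite !inE => /orP[/orP[]|].
- case/imsetP => f fH ->; rewrite card_imset; last exact: inl_inj.
  by move/forall_inP: (edges_card2 H1) => /(_ f fH).
- case/imsetP => f fH ->; rewrite card_imset; last exact: inr_inj.
  by move/forall_inP: (edges_card2 H2) => /(_ f fH).
- by case/imset2P => i x _ _ ->; rewrite cards2.
Qed.

Definition circ (k : nat) (H1 : sgraph 'I_k) (H2 : sgraph (cube k)) :
    sgraph ('I_k + cube k)%type := SGraph (circ_card2 H1 H2).

Definition calB (k : nat) : classical_sets.set (sgraph ('I_k + cube k)%type) :=
  fun G => exists (H1 : sgraph 'I_k) (E : 'I_k -> {set {set cube k}}),
    (forall i : 'I_k, E i \in coverings (bip i) (cube2 (closed_neighbours H1 i)))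
    /\ G = circ H1 (span (\bigcup_(i : 'I_k) E i)).

Arguments calB : clear implicits.

Definition poset_on (T : Type) (A : classical_sets.set T) (le : rel T) : Prop :=
  [/\ forall x, A x -> le x x,
      forall x y, A x -> A y -> le x y -> le y x -> x = y &
      forall x y z, A x -> A y -> A z -> le x y -> le y z -> le x z].

Definition least_upper_bound (T : Type) (A : classical_sets.set T) (le : rel T)
    (x y z : T) : Prop :=
  [/\ A z, le x z, le y z &
      forall w, A w -> le x w -> le y w -> le z w].

Definition join_semilattice_on (T : Type) (A : classical_sets.set T)
    (le : rel T) : Prop :=
  poset_on A le /\
  forall x y, A x -> A y -> exists z, least_upper_bound A le x y z.

Definition maximum_of (T : Type) (A : classical_sets.set T) (le : rel T)
    (m : T) : Prop :=
  A m /\ forall a, A a -> le a m.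

(* Main.v *)
Require Import Defs.
From mathcomp Require Import all_boot.
From mathcomp Require classical_sets cardinality.

(** Enlarging [H1] enlarges the closed neighbourhoods and so shrinks the sets
    to be covered. Hence the union of two members of [calB k], taken on [H1] and
    on each [E i] separately, is again a member. *)

Lemma sgraph_union_card2 (T : finType) (G1 G2 : sgraph T) :
  [forall e in edges G1 :|: edges G2, #|e| == 2].
Proof.
apply/forall_inP => e /setUP[]; first exact: (forall_inP (edges_card2 G1)).
exact: (forall_inP (edges_card2 G2)).
Qed.

Definition sgraph_union (T : finType) (G1 G2 : sgraph T) : sgraph T :=
  SGraph (sgraph_union_card2 T G1 G2).

(** A graph is determined by its edge set, since the field [edges_card2] is a boolean proof and
    hence unique. *)
Lemma spanning_subgraph_antisym (T : finType) (G1 G2 : sgraph T) :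
  spanning_subgraph G1 G2 -> spanning_subgraph G2 G1 -> G1 = G2.
Proof. by move=> s12 s21; apply/val_inj/eqP; rewrite eqEsubset; apply/andP. Qed.

Lemma spanning_subgraph_complete (T : finType) (G : sgraph T) :
  spanning_subgraph G (complete T).
Proof.
by apply/subsetP => e eG; rewrite inE; apply: (forall_inP (edges_card2 G)).
Qed.

Lemma circ_mono (k : nat) (H1 H1' : sgraph 'I_k) (H2 H2' : sgraph (cube k)) :
  spanning_subgraph H1 H1' -> spanning_subgraph H2 H2' ->
  spanning_subgraph (circ H1 H2) (circ H1' H2').
Proof. by move=> s1 s2; rewrite /spanning_subgraph !setUSS ?imsetS. Qed.

Lemma circ_union (k : nat) (H1 H1' : sgraph 'I_k) (H2 H2' : sgraph (cube k)) :
  circ (sgraph_union _ H1 H1') (sgraph_union _ H2 H2') =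
  sgraph_union _ (circ H1 H2) (circ H1' H2').
Proof.
apply: val_inj; rewrite /= /circ_edges !imsetU.
(* The cross edges depend on neither argument of [circ]. They occur once on the left and twice on
   the right, so they are duplicated before regrouping. *)
by rewrite setUACA -[in LHS](setUid [set [set inl i; inr x] | i in _, x in _])
  (setUACA _ _ (imset2 _ _ _)).
Qed.

(** The cardinality filter in [span] commutes with unions. *)
Lemma span_bigcup_union (T I : finType) (E F : I -> {set {set T}}) :
  span (\bigcup_i (E i :|: F i)) =
  sgraph_union _ (span (\bigcup_i E i)) (span (\bigcup_i F i)).
Proof.
by apply: val_inj; rewrite /= big_split /=; apply/setP => e;
  rewrite !inE -andb_orl.
Qed.

Lemma closed_neighboursS {T : finType} {G H : sgraph T} (i : T) :
  spanning_subgraph G H -> closed_neighbours G i \subset closed_neighbours H i.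
Proof.
by move=> sGH; apply/setUS/subsetP => j; rewrite !inE; apply: (subsetP sGH).
Qed.

Lemma cube2S {k : nat} {I J : {set 'I_k}} :
  I \subset J -> cube2 J \subset cube2 I.
Proof.
move=> sIJ; apply/subsetP => x; rewrite !inE => /forall_inP xJ.
by apply/forall_inP => i /(subsetP sIJ) /xJ.
Qed.

Lemma coverings_subset {T : finType} {F : sgraph T} {S S' : {set T}}
    {E : {set {set T}}} :
  S' \subset S -> E \in coverings F S -> E \in coverings F S'.
Proof.
move=> sS; rewrite !inE => /andP[-> /forall_inP cE] /=.
by apply/forall_inP => v /(subsetP sS) /cE.
Qed.

Lemma coverings_union (T : finType) (F : sgraph T) (S : {set T})
    (E E' : {set {set T}}) :
  E \in coverings F S -> E' \in coverings F S -> E :|: E' \in coverings F S.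
Proof.
rewrite !inE subUset => /andP[-> /forall_inP cE] /andP[-> _] /=.
apply/forall_inP => v /cE /exists_inP[e eE ve].
by apply/exists_inP; exists e; rewrite ?inE ?eE.
Qed.

Lemma calB_union (k : nat) (G G' : sgraph ('I_k + cube k)%type) :
  calB k G -> calB k G' -> calB k (sgraph_union _ G G').
Proof.
case=> H [E [cE ->]] [H' [E' [cE' ->]]].
exists (sgraph_union _ H H'), (fun i => E i :|: E' i).
split=> [i|]; last by rewrite span_bigcup_union circ_union.
(* Both coverings are restricted to the smaller set that the union of [H] and [H'] asks for. *)
apply: coverings_union.
- apply: coverings_subset (cE i); apply/cube2S/closed_neighboursS.
  exact: subsetUl.
- apply: coverings_subset (cE' i); apply/cube2S/closed_neighboursS.
  exact: subsetUr.
Qed.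

Lemma entry_cases (a : 'I_2) : a = entry1 \/ a = entry2.
Proof. by case: a => [[|[|//]] lta]; [left|right]; apply: val_inj. Qed.

Lemma bip_edges_covering (k : nat) (H : sgraph 'I_k) (i : 'I_k) :
  bip_edges i \in coverings (bip i) (cube2 (closed_neighbours H i)).
Proof.
rewrite inE subxx /=; apply/forall_inP => x; rewrite inE => /forall_inP x2.
(* The all-ones vector lies in the half opposite to [x]: as [i] is in its own closed neighbourhood,
   [x i] is [entry2]. *)
apply/exists_inP; exists [set [ffun=> entry1]; x]; last by rewrite !inE eqxx orbT.
by apply: imset2_f; rewrite inE ?ffunE // x2 // !inE eqxx.
Qed.

(** Two distinct vectors differ in some coordinate [i], and the edge joining them then belongs to
    [bip i]. *)
Lemma span_bip_edges (k : nat) :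
  span (\bigcup_(i : 'I_k) bip_edges i) = complete (cube k).
Proof.
apply: val_inj => /=; apply/setP => e; rewrite !inE andb_idl //.
case/cards2P => x [y [xy ->]].
have /existsP[i xyi] : [exists i, x i != y i].
  by rewrite -negb_forall; apply: contra xy => /eqfunP /ffunP ->.
apply/bigcupP; exists i => //.
have [xi|xi] := entry_cases (x i); have [yi|yi] := entry_cases (y i);
  try by rewrite xi yi eqxx in xyi.
- by apply: imset2_f; rewrite inE ?xi ?yi.
(* [bip_edges] lists the endpoint with entry 1 first, which here is [y]. *)
- by rewrite setUC; apply: imset2_f; rewrite inE ?xi ?yi.
Qed.

(** Each [E i] is taken as large as possible, namely all of [bip_edges i]. *)
Lemma calB_complete (k : nat) :
  calB k (circ (complete 'I_k) (complete (cube k))).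
Proof.
exists (complete _), (@bip_edges k); split; last by rewrite span_bip_edges.
exact: bip_edges_covering.
Qed.

Theorem proposition4p3 (k : nat) (hk : 2 <= k) :
  cardinality.finite_set (calB k) /\
  join_semilattice_on (calB k) (@spanning_subgraph ('I_k + cube k)%type) /\
  maximum_of (calB k) (@spanning_subgraph ('I_k + cube k)%type)
    (circ (complete 'I_k) (complete (cube k))).
Proof.
(* There are finitely many graphs on a finite vertex set. *)
split; first exact: cardinality.finite_finset.
split; last first.
  split; first exact: calB_complete.
  by move=> _ [H [E [_ ->]]]; apply: circ_mono; apply: spanning_subgraph_complete.
split.
  split=> [G _|G G' _ _|G1 G2 G3 _ _ _]; first exact: subxx.
  - exact: spanning_subgraph_antisym.
  - exact: subset_trans.
(* The union is the least upper bound among all graphs on this vertex set, so it remains one inside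
   [calB k] once it is known to lie there. *)
move=> G G' BG BG'; exists (sgraph_union _ G G'); split.
- exact: calB_union.
- exact: subsetUl.
- exact: subsetUr.
- by move=> W _ sG sG'; rewrite /spanning_subgraph subUset; apply/andP.
Qed.
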